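(* Let $\mathcal{C}$ be a triangulated category, $\mathcal{P}$ a silting subcategory of $\mathcal{C}$, and $d$ a positive integer. Let $\mathcal{S}$ be a contravariantly finite presilting subcategory of $\mathcal{C}$ that is $(d+1)$-term with respect to $\mathcal{P}$, i.e. $\mathcal{S}\subseteq\mathcal{P}^{[0,d]}$. Then $\mathcal{S}$ is silting if and only if $\mathcal{C}_{\mathcal{S}}^{\le 0}\subseteq\mathcal{C}_{\mathcal{P}}^{\le 0}$.
   Context: Conventions: $[1]$ is the shift functor. $\operatorname{add}\mathcal{X}$ is the full subcategory of direct summands of finite direct sums of objects of $\mathcal{X}$. A subcategory of an additive category means a full subcategory $\mathcal{X}$ with $\mathcal{X}=\operatorname{add}\mathcal{X}$. $\operatorname{Hom}(\mathcal{X},\mathcal{Y})=0$ means $\operatorname{Hom}(X,Y)=0$ for all $X\in\mathcal{X}$, $Y\in\mathcal{Y}$. A morphism $f:X\to Y$ is a right $\mathcal{X}$-approximation of $Y$ if $X\in\mathcal{X}$ and every morphism $X'\to Y$ with $X'\in\mathcal{X}$ factors through $f$; $\mathcal{X}$ is contravariantly finite in $\mathcal{C}$ if every object of $\mathcal{C}$ has a right $\mathcal{X}$-approximation. For a subcategory $\mathcal{X}$ of $\mathcal{C}$, $\mathcal{C}^{\le 0}_{\mathcal{X}}=\{Y\in\mathcal{C}\mid\operatorname{Hom}(\mathcal{X},Y[i])=0\text{ for all }i>0\}$. $\mathcal{X}*\mathcal{Y}$ is the full subcategory of objects $Z$ admitting a triangle $X\to Z\to Y\to X[1]$ with $X\in\mathcal{X}$,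 $Y\in\mathcal{Y}$, and $\mathcal{P}^{[0,d]}=\mathcal{P}*\mathcal{P}[1]*\cdots*\mathcal{P}[d]$. A subcategory $\mathcal{S}$ of $\mathcal{C}$ is presilting if $\operatorname{Hom}(\mathcal{S},\mathcal{S}[i])=0$ for all $i>0$, and silting if moreover the smallest triangulated subcategory of $\mathcal{C}$ containing $\mathcal{S}$ is $\mathcal{C}$ itself. *)

(* Defs.v *)
From mathcomp Require Import all_boot all_algebra.

Set Implicit Arguments.
Unset Strict Implicit.
Unset Printing Implicit Defensive.

Import GRing.Theory.
Local Open Scope ring_scope.

Reserved Notation "g \oc f" (at level 40, left associativity).

Record preadditiveCat := PreadditiveCat {
  obj :> Type;
  hom : obj -> obj -> zmodType;
  idm : forall X, hom X X;
  compm : forall X Y Z, hom Y Z -> hom X Y -> hom X Z;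
  compmA : forall X Y Z W (h : hom Z W) (g : hom Y Z) (f : hom X Y),
    compm h (compm g f) = compm (compm h g) f;
  comp1m : forall X Y (f : hom X Y), compm (idm Y) f = f;
  compm1 : forall X Y (f : hom X Y), compm f (idm X) = f;
  compmDl : forall X Y Z (g g' : hom Y Z) (f : hom X Y),
    compm (g + g') f = compm g f + compm g' f;
  compmDr : forall X Y Z (g : hom Y Z) (f f' : hom X Y),
    compm g (f + f') = compm g f + compm g f'
}.

Arguments hom {p} X Y.
Arguments idm {p} X.
Notation "g \oc f" := (compm g f).

Section Preadditive.
Variable C : preadditiveCat.
Implicit Types X Y Z W : C.

Definition is_iso X Y (f : hom X Y) : Prop :=
  exists g : hom Y X, g \oc f = idm X /\ f \oc g = idm Y.

Definition isomorphic X Y : Prop := exists f : hom X Y, is_iso f.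

Definition is_zero_obj Z : Prop :=
  (forall X (f : hom X Z), f = 0) /\ (forall X (f : hom Z X), f = 0).

Definition is_direct_sum (I : finType) (F : I -> C) W : Prop :=
  exists (inc : forall i, hom (F i) W) (prj : forall i, hom W (F i)),
    [/\ forall i, prj i \oc inc i = idm (F i),
        forall i j, i != j -> prj i \oc inc j = 0
      & \sum_(i : I) (inc i \oc prj i) = idm W].

Definition direct_summand Y W : Prop :=
  exists Y', is_direct_sum (fun b : bool => if b then Y else Y') W.

(* A full subcategory is given by its predicate on objects. *)
Definition add_closure (A : C -> Prop) : C -> Prop := fun Y =>
  exists (n : nat) (F : 'I_n -> C) (W : C),
    [/\ forall i, A (F i), is_direct_sum F W & direct_summand Y W].

Definition is_subcategory (A : C -> Prop) : Prop :=
  forall Y, A Y <-> add_closure A Y.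

Definition right_approximation (A : C -> Prop) X Y (f : hom X Y) : Prop :=
  A X /\ forall X' (f' : hom X' Y), A X' -> exists g : hom X' X, f' = f \oc g.

Definition contravariantly_finite (A : C -> Prop) : Prop :=
  forall Y, exists X (f : hom X Y), right_approximation A f.

End Preadditive.

Record additiveEndofunctor (C : preadditiveCat) := AdditiveEndofunctor {
  fobj :> C -> C;
  fmap : forall X Y : C, hom X Y -> hom (fobj X) (fobj Y);
  fmap1 : forall X : C, fmap (idm X) = idm (fobj X);
  fmapM : forall (X Y Z : C) (g : hom Y Z) (f : hom X Y),
    fmap (g \oc f) = fmap g \oc fmap f;
  fmapD : forall (X Y : C) (f g : hom X Y), fmap (f + g) = fmap f + fmap g
}.

(* [susp] is only required to be an autoequivalence, not an automorphism;
   [desusp] is a chosen quasi-inverse. *)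
Record triangulatedCat := TriangulatedCat {
  tcat :> preadditiveCat;
  direct_sum_ex : forall n (F : 'I_n -> tcat), exists W, is_direct_sum F W;

  susp : additiveEndofunctor tcat;
  desusp : additiveEndofunctor tcat;
  desuspK : forall X, hom (desusp (susp X)) X;
  desuspK_iso : forall X, is_iso (desuspK X);
  desuspK_nat : forall (X Y : tcat) (f : hom X Y),
    f \oc desuspK X = desuspK Y \oc fmap desusp (fmap susp f);
  suspK : forall X, hom (susp (desusp X)) X;
  suspK_iso : forall X, is_iso (suspK X);
  suspK_nat : forall (X Y : tcat) (f : hom X Y),
    f \oc suspK X = suspK Y \oc fmap susp (fmap desusp f);

  dist : forall X Y Z : tcat, hom X Y -> hom Y Z -> hom Z (susp X) -> Prop;
  dist_iso : forall (X Y Z X' Y' Z' : tcat)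
      (f : hom X Y) (g : hom Y Z) (h : hom Z (susp X))
      (f' : hom X' Y') (g' : hom Y' Z') (h' : hom Z' (susp X'))
      (a : hom X X') (b : hom Y Y') (c : hom Z Z'),
    is_iso a -> is_iso b -> is_iso c ->
    b \oc f = f' \oc a -> c \oc g = g' \oc b -> fmap susp a \oc h = h' \oc c ->
    dist f g h -> dist f' g' h';
  dist_id : forall X Z : tcat, is_zero_obj Z ->
    dist (idm X) (0 : hom X Z) (0 : hom Z (susp X));
  dist_cone : forall (X Y : tcat) (f : hom X Y),
    exists Z (g : hom Y Z) (h : hom Z (susp X)), dist f g h;
  dist_rotate : forall (X Y Z : tcat)
      (f : hom X Y) (g : hom Y Z) (h : hom Z (susp X)),
    dist f g h <-> dist g h (- fmap susp f);
  dist_complete : forall (X Y Z X' Y' Z' : tcat)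
      (f : hom X Y) (g : hom Y Z) (h : hom Z (susp X))
      (f' : hom X' Y') (g' : hom Y' Z') (h' : hom Z' (susp X'))
      (a : hom X X') (b : hom Y Y'),
    dist f g h -> dist f' g' h' -> b \oc f = f' \oc a ->
    exists c : hom Z Z',
      c \oc g = g' \oc b /\ fmap susp a \oc h = h' \oc c;
  dist_octahedral : forall (X Y Z X' Y' Z' : tcat)
      (u : hom X Y) (j : hom Y Z') (k : hom Z' (susp X))
      (v : hom Y Z) (l : hom Z X') (m : hom X' (susp Y))
      (n : hom Z Y') (o : hom Y' (susp X)),
    dist u j k -> dist v l m -> dist (v \oc u) n o ->
    exists (f : hom Z' Y') (g : hom Y' X'),
      dist f g (fmap susp j \oc m) /\
      [/\ f \oc j = n \oc v, o \oc f = k, g \oc n = l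
        & m \oc g = fmap susp u \oc o]
}.

Section Silting.
Variable C : triangulatedCat.
Implicit Types (X Y Z : C) (A B S T P : C -> Prop).

Definition shift (i : nat) X : C := iter i (susp C) X.

Definition shift_sub A (i : nat) : C -> Prop :=
  fun Y => exists2 X, A X & isomorphic Y (shift i X).

Definition hom_vanish A B : Prop :=
  forall X Y, A X -> B Y -> forall f : hom X Y, f = 0.

Definition sub_le A B : Prop := forall X, A X -> B X.

(* C_A^{<= 0} *)
Definition le0_part A : C -> Prop :=
  fun Y => forall i, (0 < i)%N -> forall X, A X ->
    forall f : hom X (shift i Y), f = 0.

(* A * B *)
Definition ext_sub A B : C -> Prop := fun Z =>
  exists X Y (f : hom X Z) (g : hom Z Y) (h : hom Y (susp C X)),
    [/\ A X, B Y & dist f g h].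

(* P^{[0,d]}, bracketed to the left: [ext_sub] is associative by the
   octahedral axiom. *)
Fixpoint term_sub P (d : nat) : C -> Prop :=
  if d is d'.+1 then ext_sub (term_sub P d') (shift_sub P d'.+1) else P.

(* Since subcategories are add-closed, these are the thick subcategories. *)
Definition triangulated_sub T : Prop :=
  [/\ is_subcategory T,
      forall X, T X -> T (susp C X),
      forall X, T X -> T (desusp C X)
    & forall X Y Z (f : hom X Y) (g : hom Y Z) (h : hom Z (susp C X)),
        dist f g h -> T X -> T Y -> T Z].

Definition triangulated_hull A : C -> Prop :=
  fun X => forall T, triangulated_sub T -> sub_le A T -> T X.

Definition presilting S : Prop :=
  is_subcategory S /\
  forall i, (0 < i)%N -> hom_vanish S (shift_sub S i).

Definition silting S : Prop :=
  presilting S /\ forall X, triangulated_hull S X.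

End Silting.

(* Main.v *)
Require Import Defs.
From mathcomp Require Import all_boot all_algebra.

(** Contravariant finiteness gives, for [X] in [C_S^{<=0}], a triangle
    [S0 -> X -> Y[1] -> S0[1]] with [S0] in [S] and [Y] again in [C_S^{<=0}].
    Iterating, [X] maps to some [Y[m]] with [Y] in [C_S^{<=0}] and cone in the
    thick hull of [S].

    If [C_S^{<=0}] is contained in [C_P^{<=0}], take [X = Q[d]] with [Q] in [P]
    and [m = d + 1]: the map [Q[d] -> Y[d + 1]] vanishes, so [Q[d + 1]] is a
    summand of its cone, and [P] lies in the thick hull of [S].

    Conversely, the objects [X] with [Hom(X, Y[i]) = 0] for all [Y] in
    [C_S^{<=0}] and all large [i] form a thick subcategory containing [S], hence
    everything when [S] is silting.  Since [Hom(Q, S0[i]) = 0] for [i > 0], the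
    triangle embeds [Hom(Q, Y[i])] in [Hom(Q, Y'[i + 1])] with [Y'] in
    [C_S^{<=0}], so the vanishing descends from large [i] to every [i > 0]. *)

Set Implicit Arguments.
Unset Strict Implicit.
Unset Printing Implicit Defensive.

(* [all_algebra] shadows [hom]. *)
Import Defs.
Import GRing.Theory.
Local Open Scope ring_scope.

(** * Vanishing of Hom and direct sums in preadditive categories *)

Section Preadditive.
Variable C : preadditiveCat.
Implicit Types X Y Z W : C.

Lemma comp0m X Y Z (f : hom X Y) : (0 : hom Y Z) \oc f = 0.
Proof. by apply: (addrI (0 \oc f)); rewrite -compmDl !addr0. Qed.

Lemma compm0 X Y Z (g : hom Y Z) : g \oc (0 : hom X Y) = 0.
Proof. by apply: (addrI (g \oc 0)); rewrite -compmDr !addr0. Qed.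

Lemma compNm X Y Z (g : hom Y Z) (f : hom X Y) : (- g) \oc f = - (g \oc f).
Proof. by apply: (addrI (g \oc f)); rewrite -compmDl !subrr comp0m. Qed.

Lemma compmN X Y Z (g : hom Y Z) (f : hom X Y) : g \oc (- f) = - (g \oc f).
Proof. by apply: (addrI (g \oc f)); rewrite -compmDr !subrr compm0. Qed.

Lemma compm_sumr X Y Z (I : finType) (g : hom Y Z) (F : I -> hom X Y) :
  g \oc (\sum_i F i) = \sum_i g \oc F i.
Proof.
apply: (big_morph (fun f => g \oc f)); last exact: compm0.
by move=> f f'; exact: compmDr.
Qed.

Lemma is_iso_idm X : is_iso (idm X).
Proof. by exists (idm X); rewrite comp1m. Qed.

Lemma isomorphic_refl X : isomorphic X X.
Proof. by exists (idm X); exact: is_iso_idm. Qed.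

Lemma isomorphic_sym X Y : isomorphic X Y -> isomorphic Y X.
Proof. by move=> [f [g [gf fg]]]; exists g, f. Qed.

Lemma is_iso_cancelr X Y Z (e : hom X Y) (f g : hom Y Z) :
  is_iso e -> f \oc e = g \oc e -> f = g.
Proof.
move=> [e' [_ ee']] /(congr1 (fun u => u \oc e')).
by rewrite -!compmA ee' !compm1.
Qed.

Lemma is_iso_cancell X Y Z (e : hom Y Z) (f g : hom X Y) :
  is_iso e -> e \oc f = e \oc g -> f = g.
Proof.
move=> [e' [e'e _]] /(congr1 (fun u => e' \oc u)).
by rewrite !compmA e'e !comp1m.
Qed.

Lemma idm0_zero_obj Z : idm Z = 0 -> is_zero_obj Z.
Proof.
move=> id0; split=> X f; first by rewrite -(comp1m f) id0 comp0m.
by rewrite -(compm1 f) id0 compm0.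
Qed.

Definition no_hom X Y : Prop := forall f : hom X Y, f = 0.

Lemma no_hom_retractl X Y Z (s : hom X Y) (r : hom Y X) :
  r \oc s = idm X -> no_hom Y Z -> no_hom X Z.
Proof.
by move=> rs nYZ f; rewrite -(compm1 f) -rs compmA (nYZ (f \oc r)) comp0m.
Qed.

Lemma no_hom_isol X Y Z : isomorphic X Y -> no_hom Y Z -> no_hom X Z.
Proof. by move=> [s [r [rs _]]]; exact: no_hom_retractl rs. Qed.

Lemma no_hom_isor X Y Z : isomorphic X Y -> no_hom Z Y -> no_hom Z X.
Proof.
move=> [s [r [rs _]]] nZY f.
by rewrite -(comp1m f) -rs -compmA (nZY (s \oc f)) compm0.
Qed.

Lemma no_hom_direct_sum (I : finType) (F : I -> C) W Y :
  is_direct_sum F W -> (forall i, no_hom (F i) Y) -> no_hom W Y.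
Proof.
move=> [inc [prj [_ _ id_sum]]] nF f.
rewrite -(compm1 f) -id_sum compm_sumr big1 // => i _.
by rewrite compmA (nF i (f \oc inc i)) comp0m.
Qed.

Lemma direct_sum_single X : is_direct_sum (fun _ : 'I_1 => X) X.
Proof.
exists (fun=> idm X), (fun=> idm X); split.
- by move=> i; rewrite comp1m.
- by move=> i j; rewrite !ord1.
- by rewrite big_ord1 comp1m.
Qed.

Lemma direct_summand_biproduct X Y W (s : hom X W) (o : hom W X)
    (n : hom Y W) (t : hom W Y) :
  o \oc s = idm X -> t \oc n = idm Y -> o \oc n = 0 -> t \oc s = 0 ->
  s \oc o + n \oc t = idm W -> direct_summand X W.
Proof.
move=> os tn on ts id_sum; exists Y.
exists (fun b => if b as b return hom (if b then X else Y) W then s else n).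
exists (fun b => if b as b return hom W (if b then X else Y) then o else t).
by split=> [[]|[] []|] //; rewrite big_bool.
Qed.

Lemma direct_summand_no_hom X Z W : direct_summand X W ->
  no_hom W Z -> no_hom X Z.
Proof.
move=> [Y [inc [prj [retr _ _]]]].
exact: no_hom_retractl (retr true).
Qed.

Lemma isomorphic_direct_summand X W Z : is_zero_obj Z ->
  isomorphic X W -> direct_summand X W.
Proof.
move=> [toZ fromZ] [e [e' [e'e ee']]].
apply: (@direct_summand_biproduct _ Z _ e e' 0 0) => //.
  by rewrite (toZ _ (idm Z)) (toZ _ (0 \oc 0)).
by rewrite compm0 addr0.
Qed.

End Preadditive.

(** * Additive endofunctors *)

Section AdditiveEndofunctor.
Variables (C : preadditiveCat) (F : additiveEndofunctor C).
Implicit Types X Y : C.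

Lemma fmap0 X Y : fmap F (0 : hom X Y) = 0.
Proof. by apply: (addrI (fmap F (0 : hom X Y))); rewrite -fmapD !addr0. Qed.

Lemma isomorphic_fobj X Y : isomorphic X Y -> isomorphic (F X) (F Y).
Proof.
move=> [f [g [gf fg]]]; exists (fmap F f), (fmap F g).
by rewrite -!fmapM gf fg !fmap1.
Qed.

Lemma zero_obj_fobj X : is_zero_obj X -> is_zero_obj (F X).
Proof.
by move=> [toX _]; apply: idm0_zero_obj; rewrite -fmap1 (toX _ (idm X)) fmap0.
Qed.

End AdditiveEndofunctor.

(** * Suspension, exactness of triangles and splitting *)

Section Triangulated.
Variable C : triangulatedCat.
Implicit Types X Y Z W : C.

Lemma zero_obj_ex : exists Z : C, is_zero_obj Z.
Proof.
have [Z [inc [prj [_ _]]]] := @direct_sum_ex C 0 (fun i : 'I_0 => match i with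
  Ordinal _ lt0 => False_rect _ (notF lt0) end).
by rewrite big_ord0 => /esym /idm0_zero_obj; exists Z.
Qed.

Lemma fmap_susp_inj X Y : injective (@fmap _ (susp C) X Y).
Proof.
move=> f g fg; apply: is_iso_cancelr (desuspK_iso X) _.
by rewrite !desuspK_nat fg.
Qed.

Lemma fmap_desusp_inj X Y : injective (@fmap _ (desusp C) X Y).
Proof.
move=> f g fg; apply: is_iso_cancelr (suspK_iso X) _.
by rewrite !suspK_nat fg.
Qed.

(** The preimage is [desusp c] transported along [desuspK]; faithfulness of [desusp] reduces the
    equation to naturality of [desuspK]. *)
Lemma fmap_susp_full X Y (c : hom (susp C X) (susp C Y)) :
  exists v : hom X Y, fmap (susp C) v = c.
Proof.
have [e [ee _]] := desuspK_iso X.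
exists (desuspK Y \oc fmap (desusp C) c \oc e).
apply: fmap_desusp_inj; apply: is_iso_cancell (desuspK_iso Y) _.
by rewrite -desuspK_nat -compmA ee compm1.
Qed.

Lemma no_hom_susp X Y : no_hom (susp C X) (susp C Y) <-> no_hom X Y.
Proof.
split=> [nXY f | nXY f]; first by apply: fmap_susp_inj; rewrite fmap0; exact: nXY.
by have [v <-] := fmap_susp_full f; rewrite (nXY v) fmap0.
Qed.

Lemma no_hom_shift i X Y : no_hom (shift i X) (shift i Y) <-> no_hom X Y.
Proof. by elim: i => //= i IHi; apply: iff_trans (no_hom_susp _ _) IHi. Qed.

Lemma shift_susp i X : shift i (susp C X) = shift i.+1 X.
Proof. by rewrite /shift -iterSr. Qed.

Lemma shift_shift i j X : shift i (shift j X) = shift (i + j) X.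
Proof. by rewrite /shift iterD. Qed.

Lemma isomorphic_shift i X Y :
  isomorphic X Y -> isomorphic (shift i X) (shift i Y).
Proof. by move=> XY; elim: i => //= i; exact: isomorphic_fobj. Qed.

Lemma dist_comp0 X Y Z (f : hom X Y) (g : hom Y Z) (h : hom Z (susp C X)) :
  dist f g h -> g \oc f = 0.
Proof.
move=> dfgh; have [O zO] := zero_obj_ex.
have [c [<- _]] := dist_complete (a := idm X) (b := f) (dist_id X zO) dfgh erefl.
exact: compm0.
Qed.

(** The factorization is a component of a morphism from the triangle W = W -> 0. As [dist_complete]
    only supplies third components, both triangles are rotated once and the component found is
    desuspended by fullness. *)
Lemma dist_factorl X Y Z W (f : hom X Y) (g : hom Y Z) (h : hom Z (susp C X))
    (u : hom W Y) :
  dist f g h -> g \oc u = 0 -> exists v : hom W X, u = f \oc v.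
Proof.
move=> /dist_rotate dfgh gu; have [O zO] := zero_obj_ex.
have /dist_rotate dW := dist_id W zO.
have [|c [_]] := dist_complete (a := u) (b := 0) dW dfgh.
  by rewrite compm0 gu.
have [v <-] := fmap_susp_full c; rewrite compmN compNm -!fmapM compm1.
by move=> /oppr_inj /fmap_susp_inj ->; exists v.
Qed.

(** Dually, compare with the triangle 0 -> W = W. *)
Lemma dist_factorr X Y Z W (f : hom X Y) (g : hom Y Z) (h : hom Z (susp C X))
    (u : hom Y W) :
  dist f g h -> u \oc f = 0 -> exists v : hom Z W, u = v \oc g.
Proof.
move=> dfgh uf; have [O zO] := zero_obj_ex.
have dW : dist (0 : hom O W) (idm W) (0 : hom W (susp C O)).
  apply/dist_rotate; rewrite fmap0 oppr0.
  exact: dist_id (zero_obj_fobj _ zO).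
have [|c [cg _]] := dist_complete (a := 0 : hom X O) (b := u) dfgh dW.
  by rewrite uf comp0m.
by exists c; rewrite cg comp1m.
Qed.

Lemma dist_susp X Y Z (f : hom X Y) (g : hom Y Z) (h : hom Z (susp C X)) :
  dist f g h ->
  dist (- fmap (susp C) f) (- fmap (susp C) g) (- fmap (susp C) h).
Proof. by move=> /dist_rotate /dist_rotate /dist_rotate. Qed.

(** A zero first map makes [h] a split epimorphism and [g] a split monomorphism. The section [s]
    leaves [idm Z - s \oc h], which factors through [g] and gives the other projection [t]. *)
Lemma dist0_direct_summand X Y Z (g : hom Y Z) (h : hom Z (susp C X)) :
  dist (0 : hom X Y) g h -> direct_summand (susp C X) Z.
Proof.
move=> d0; have /dist_rotate d1 := d0; have /dist_rotate d2 := d1.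
have [|s os] := dist_factorl (u := idm (susp C X)) d2.
  by rewrite fmap0 oppr0 comp0m.
have [|r rg] := dist_factorr (u := idm Y) d0; first by rewrite compm0.
have hg := dist_comp0 d1.
have [|t gt] := dist_factorl (u := idm Z - s \oc h) d1.
  by rewrite compmDr compmN compmA -os comp1m compm1 subrr.
have g_mono W (a b : hom W Y) : g \oc a = g \oc b -> a = b.
  by move=> /(congr1 (fun u => r \oc u)); rewrite !compmA -rg !comp1m.
apply: (@direct_summand_biproduct _ _ Y _ s h g t) => //.
- apply: g_mono; rewrite compmA -gt compmDl compNm -compmA hg compm0 subr0.
  by rewrite comp1m compm1.
- apply: g_mono; rewrite compmA -gt compmDl compNm -compmA -os comp1m compm1.
  by rewrite subrr compm0.
- by rewrite -gt addrC subrK.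
Qed.

(** Forgetting the maps absorbs the signs created by rotation. *)
Definition triangle X Y Z : Prop :=
  exists (f : hom X Y) (g : hom Y Z) (h : hom Z (susp C X)), dist f g h.

Lemma triangle_rotate X Y Z : triangle X Y Z -> triangle Y Z (susp C X).
Proof. by move=> [f [g [h /dist_rotate ?]]]; do 3!eexists; eauto. Qed.

Lemma triangle_shift i X Y Z :
  triangle X Y Z -> triangle (shift i X) (shift i Y) (shift i Z).
Proof.
move=> tXYZ; elim: i => //= i IHi.
by do 3!apply: triangle_rotate.
Qed.

Lemma no_hom_to_extension W X Y Z :
  triangle X Y Z -> no_hom W X -> no_hom W Z -> no_hom W Y.
Proof.
move=> [f [g [h dfgh]]] nX nZ u.
have [v ->] := dist_factorl dfgh (nZ (g \oc u)).
by rewrite (nX v) compm0.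
Qed.

Lemma no_hom_from_extension W X Y Z :
  triangle X Y Z -> no_hom X W -> no_hom Z W -> no_hom Y W.
Proof.
move=> [f [g [h dfgh]]] nX nZ u.
have [v ->] := dist_factorr dfgh (nX (u \oc f)).
by rewrite (nZ v) comp0m.
Qed.

(** * Thick subcategories and morphisms with cone in them *)

Section TriangulatedSub.
Variables (T : C -> Prop) (hT : triangulated_sub T).

Lemma triangulated_sub_summand X W : direct_summand X W -> T W -> T X.
Proof.
case: hT => Tadd _ _ _ XW TW; apply/Tadd; exists 1, (fun=> W), W.
by split=> //; exact: direct_sum_single.
Qed.

Lemma triangulated_sub_iso X Y : isomorphic X Y -> T Y -> T X.
Proof.
have [O zO] := zero_obj_ex => XY.
exact: triangulated_sub_summand (isomorphic_direct_summand zO XY).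
Qed.

Lemma triangulated_sub_zero Z : is_zero_obj Z -> T Z.
Proof.
move=> zZ; case: hT => Tadd _ _ _; apply/Tadd; exists 0, (fun=> Z), Z; split.
- by case.
- exists (fun=> 0), (fun=> 0); split; try by case.
  by rewrite big_ord0; have [toZ _] := zZ; rewrite (toZ _ (idm Z)).
- exact: isomorphic_direct_summand zZ (isomorphic_refl Z).
Qed.

Lemma triangulated_sub_desusp X : T (susp C X) -> T X.
Proof.
case: hT => _ _ Tdesusp _ /Tdesusp; apply: triangulated_sub_iso.
by apply: isomorphic_sym; exists (desuspK X); exact: desuspK_iso.
Qed.

Lemma triangulated_sub_unshift i X : T (shift i X) -> T X.
Proof. by elim: i => //= i IHi /triangulated_sub_desusp. Qed.

(** Two rotations exhibit Y[1] as a cone of Z -> X[1]. *)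
Lemma triangulated_sub_extension X Y Z : triangle X Y Z -> T X -> T Z -> T Y.
Proof.
move=> /triangle_rotate /triangle_rotate [f [g [h dfgh]]] TX TZ.
case: hT => _ Tsusp _ Tcone; apply: triangulated_sub_desusp.
exact: Tcone dfgh TZ (Tsusp _ TX).
Qed.

(** These are the morphisms inverted in the Verdier quotient by [T]. *)
Definition cone_in X Y (u : hom X Y) : Prop :=
  exists Z (j : hom Y Z) (k : hom Z (susp C X)), dist u j k /\ T Z.

Lemma cone_in_idm X : cone_in (idm X).
Proof.
have [O zO] := zero_obj_ex; exists O, 0, 0.
by split; [exact: dist_id | exact: triangulated_sub_zero].
Qed.

(** By the octahedral axiom the cone of the composite is an extension of the cone of [v] by that of
    [u]. *)
Lemma cone_in_comp X Y Z (u : hom X Y) (v : hom Y Z) :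
  cone_in u -> cone_in v -> cone_in (v \oc u).
Proof.
move=> [Z' [j [k [du TZ']]]] [X' [l [m [dv TX']]]].
have [Y' [n [o duv]]] := dist_cone (v \oc u).
have [f [g [dfg _]]] := dist_octahedral du dv duv.
exists Y', n, o; split=> //.
apply: (triangulated_sub_extension _ TZ' TX').
by exists f, g, (fmap (susp C) j \oc m).
Qed.

Lemma cone_in_susp X Y (u : hom X Y) :
  cone_in u -> cone_in (- fmap (susp C) u).
Proof.
move=> [Z [j [k [du TZ]]]]; do 3!eexists; split; first exact: dist_susp du.
by case: hT => _ Tsusp _ _; exact: Tsusp.
Qed.

End TriangulatedSub.

Lemma is_subcategory_from_closure (T : C -> Prop) :
  (forall (n : nat) (F : 'I_n -> C) W,
    (forall i, T (F i)) -> is_direct_sum F W -> T W) ->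
  (forall X W, direct_summand X W -> T W -> T X) -> is_subcategory T.
Proof.
move=> Tsum Tsummand X; split=> [TX | [n [F [W [TF FW XW]]]]].
- have [O zO] := zero_obj_ex; exists 1, (fun=> X), X; split=> //.
    exact: direct_sum_single.
  exact: isomorphic_direct_summand zO (isomorphic_refl X).
- exact: Tsummand XW (Tsum _ _ _ TF FW).
Qed.

(** * The thick subcategory of objects with eventually vanishing Hom *)

Section EventuallyNoHom.
Variable A : C -> Prop.

(** The bound is uniform in [Y], because the descent in [le0_part_no_hom] changes [Y] at every
    step. *)
Definition eventually_no_hom X : Prop :=
  exists n, forall Y i, A Y -> (n <= i)%N -> no_hom X (shift i Y).

Lemma eventually_no_hom_direct_sum (n : nat) (F : 'I_n -> C) W :
  (forall i, eventually_no_hom (F i)) -> is_direct_sum F W ->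
  eventually_no_hom W.
Proof.
move=> evF FW.
have [N NP] : exists N, forall j Y i, A Y -> (N <= i)%N ->
    no_hom (F j) (shift i Y).
  move: evF => {FW}; elim: n F => [|n IHn] F evF; first by exists 0 => -[].
  have [N NP] := IHn (fun j => F (lift ord0 j)) (fun j => evF _).
  have [M MP] := evF ord0.
  exists (maxn M N) => j Y i AY; rewrite geq_max => /andP[Mi Ni].
  by case: (unliftP ord0 j) => [k ->|->]; [exact: NP | exact: MP].
by exists N => Y i AY Ni; apply: no_hom_direct_sum FW _ => j; exact: NP.
Qed.

Lemma eventually_no_hom_susp X :
  eventually_no_hom X -> eventually_no_hom (susp C X).
Proof.
by move=> [n nP]; exists n.+1 => Y [|i] // AY ni; apply/no_hom_susp; exact: nP.
Qed.

Lemma eventually_no_hom_triangulated : triangulated_sub eventually_no_hom.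
Proof.
split.
- apply: is_subcategory_from_closure; first exact: eventually_no_hom_direct_sum.
  move=> X W XW [n nP]; exists n => Y i AY ni.
  exact: direct_summand_no_hom XW (nP _ _ AY ni).
- exact: eventually_no_hom_susp.
(* Hom(X[-1], Y[i]) is Hom(X, Y[i+1]), so the same bound works. *)
- move=> X [n nP]; exists n => Y i AY ni; apply/no_hom_susp.
  apply: (no_hom_isol (Y := X)); last exact: (nP _ i.+1 AY (leqW ni)).
  by exists (suspK X); exact: suspK_iso.
- move=> X Y Z f g h dfgh /eventually_no_hom_susp [m mP] [n nP].
  exists (maxn m n) => W i AW; rewrite geq_max => /andP[mi ni].
  apply: no_hom_from_extension (nP _ _ AW ni) (mP _ _ AW mi).
  by apply: triangle_rotate; exists f, g, h.
Qed.

End EventuallyNoHom.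

(** * Presilting subcategories and approximation triangles *)

Section Presilting.
Variables (A : C -> Prop) (hA : presilting A).

Lemma presilting_no_hom i X Y : (0 < i)%N -> A X -> A Y -> no_hom X (shift i Y).
Proof.
case: hA => _ van i0 AX AY; apply: van i0 _ _ AX _.
by exists Y => //; exact: isomorphic_refl.
Qed.

Lemma no_hom_from_term_sub d Z : term_sub A d Z ->
  forall i X, (d < i)%N -> A X -> no_hom Z (shift i X).
Proof.
elim: d Z => [|d IHd] Z /=.
  by move=> AZ i X i0 AX; exact: presilting_no_hom.
move=> [Z' [Y [f [g [h [tZ' [Q AQ YQ] dfgh]]]]]] i X di AX.
apply: (@no_hom_from_extension _ Z' _ Y).
- by exists f, g, h.
- exact: IHd tZ' _ _ (ltnW di) AX.
(* The last layer reduces to Hom(Q, X[i-d-1]), a positive degree since i > d+1. *)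
apply: no_hom_isol YQ _; rewrite -(subnKC (ltnW di)) -shift_shift.
by apply/no_hom_shift/presilting_no_hom; rewrite ?subn_gt0.
Qed.

Lemma no_hom_to_term_sub d Z : term_sub A d Z ->
  forall i X, (0 < i)%N -> A X -> no_hom X (shift i Z).
Proof.
elim: d Z => [|d IHd] Z /=.
  by move=> AZ i X i0 AX; exact: presilting_no_hom.
move=> [Z' [Y [f [g [h [tZ' [Q AQ YQ] dfgh]]]]]] i X i0 AX.
apply: (@no_hom_to_extension _ (shift i Z') _ (shift i Y)).
- by apply: triangle_shift; exists f, g, h.
- exact: IHd.
apply: no_hom_isor (isomorphic_shift i YQ) _; rewrite shift_shift.
by apply: presilting_no_hom; rewrite // addnS.
Qed.

Hypothesis Afin : contravariantly_finite A.

Lemma le0_part_approximation X : le0_part A X ->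
  exists S0 Y (f : hom S0 X) (g : hom X (susp C Y))
    (h : hom (susp C Y) (susp C S0)), [/\ A S0, le0_part A Y & dist f g h].
Proof.
move=> leX; have [S0 [f [AS0 approx]]] := Afin X.
have [Z [g0 [h0 d0]]] := dist_cone f.
(* The cone is replaced by an isomorphic object that is literally a suspension. *)
have [e [ee' e'e]] := suspK_iso Z.
have dfgh : dist f (e \oc g0) (h0 \oc suspK Z).
  apply: (dist_iso (is_iso_idm S0) (is_iso_idm X) _ _ _ _ d0).
  - by exists (suspK Z); split; [exact: e'e | exact: ee'].
  - by rewrite comp1m compm1.
  - by rewrite compm1.
  - by rewrite fmap1 comp1m -compmA e'e compm1.
exists S0, (desusp C Z), f, (e \oc g0), (h0 \oc suspK Z); split=> // -[//|i] _.
move=> X' AX'; rewrite -/(no_hom _ _) -shift_susp.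
(* Only degree one uses the approximation: a map to Y[1] lifts to X because Hom(A, A[1]) = 0, then
   factors through [f], so it is zero. Higher degrees lie between Hom(A, X[i]) and Hom(A,
   S0[i+1]). *)
case: i => [|i].
  move=> u; have hu : (h0 \oc suspK Z) \oc u = 0.
    exact: (@presilting_no_hom 1 _ _ isT AX' AS0).
  have /dist_rotate d1 := dfgh.
  have [v ->] := dist_factorl d1 hu.
  have [w ->] := approx _ v AX'.
  by rewrite compmA (dist_comp0 dfgh) comp0m.
apply: (@no_hom_to_extension _ (shift i.+1 X) _ (shift i.+1 (susp C S0))).
- by apply/triangle_shift/triangle_rotate; exists f, (e \oc g0), (h0 \oc suspK Z).
- exact: leX.
- by rewrite shift_susp; exact: presilting_no_hom.
Qed.

Lemma le0_part_coresolution T m X :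
  triangulated_sub T -> sub_le A T -> le0_part A X ->
  exists Y (w : hom X (shift m Y)), le0_part A Y /\ cone_in T w.
Proof.
move=> hT AT; elim: m X => [|m IHm] X leX.
  by exists X, (idm X); split=> //; exact: cone_in_idm.
have [S0 [Y1 [f [g [h [AS0 leY1 dfgh]]]]]] := le0_part_approximation leX.
have [Y [w [leY cw]]] := IHm _ leY1.
(* The cone of [g] is S0[1]; the sign, harmless here, comes from suspending the triangle on [w]. *)
exists Y, ((- fmap (susp C) w) \oc g); split=> //.
apply: (cone_in_comp hT); last exact: cone_in_susp.
have /dist_rotate d1 := dfgh.
exists (susp C S0), h, (- fmap (susp C) f); split=> //.
by case: hT => _ Tsusp _ _; apply/Tsusp/AT.
Qed.

Lemma le0_part_no_hom X :
  (forall i S0, (0 < i)%N -> A S0 -> no_hom X (shift i S0)) ->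
  eventually_no_hom (le0_part A) X ->
  forall i Y, (0 < i)%N -> le0_part A Y -> no_hom X (shift i Y).
Proof.
move=> nXA [n nP] i Y i0 leY.
(* Induction on the distance k from i to the vanishing range; each step trades k for i. *)
have [k nk] : exists k, (n <= i + k)%N by exists n; exact: leq_addl.
elim: k i Y i0 leY nk => [|k IHk] i Y i0 leY.
  by rewrite addn0 => /(nP _ _ leY).
rewrite addnS -addSn => nk.
have [S0 [Y1 [f [g [h [AS0 leY1 dfgh]]]]]] := le0_part_approximation leY.
apply: (@no_hom_to_extension _ (shift i S0) _ (shift i (susp C Y1))).
- by apply: triangle_shift; exists f, g, h.
- exact: nXA.
- by rewrite shift_susp; exact: IHk.
Qed.

End Presilting.

End Triangulated.

Theorem proposition1p7 (C : triangulatedCat) (P S : C -> Prop) (d : nat)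
  (hP : silting P) (hd : (0 < d)%N)
  (hS : presilting S) (hSfin : contravariantly_finite S)
  (hSterm : sub_le S (term_sub P d)) :
  silting S <-> sub_le (le0_part S) (le0_part P).
Proof.
have [preP hullP] := hP; split=> [[_ hullS] Y leY i i0 Q PQ | leSP].
- apply: (le0_part_no_hom hS hSfin _ _ i0 leY).
    move=> j S0 j0 SS0; exact: (no_hom_to_term_sub preP (hSterm _ SS0) j0 PQ).
  apply: hullS; first exact: eventually_no_hom_triangulated.
  (* By definition of [le0_part], objects of S have the uniform bound 1. *)
  by move=> X SX; exists 1 => Z j leZ j0; exact: leZ.
- split=> // X T hT ST; apply: (hullP X T hT) => Q PQ.
  (* S0 has layers P[0], ..., P[d], so maps from it to Q[i+d] vanish once i > 0. *)
  have leQ : le0_part S (shift d Q).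
    move=> i i0 S0 SS0; rewrite -/(no_hom _ _) shift_shift.
    apply: (no_hom_from_term_sub preP (hSterm _ SS0)) => //.
    by rewrite -[X in (X < _)%N]add0n ltn_add2r.
  have [Y [w [leY [Z [j [k [dw TZ]]]]]]] :=
    le0_part_coresolution hS hSfin d.+1 hT ST leQ.
  have w0 : w = 0.
    (* Removing d shifts leaves a map Q -> Y[1], and Y lies in C_P^{<=0} by hypothesis. *)
    move: (w); rewrite -/(no_hom _ _) -shift_susp; apply/no_hom_shift.
    exact: (leSP _ leY 1).
  rewrite w0 in dw.
  apply: (triangulated_sub_unshift hT (i := d.+1)).
  exact: (triangulated_sub_summand hT (dist0_direct_summand dw) TZ).
Qed.
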